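(* Let $1<\beta\le2$. Let $(a_{i,j})$, $(p_{i,j})$ satisfy, for some constant $A>0$, $0\le a_{i,j}=a_{j,i}\le A(i+j)$ and $0\le p_{i,j}=p_{j,i}\le1$ for all $i,j\ge1$, and let $N_{i,j}^s$ ($i,j\ge1$, $1\le s\le i+j-1$) satisfy $N_{i,j}^s=N_{j,i}^s\ge0$, $\sum_{s=1}^{i+j-1}sN_{i,j}^s=i+j$, and $N_{i,j}^s\le\alpha_0$ for a constant $\alpha_0$ and all $i,j,s$. Let $w^0=(w_i^0)_{i\in\mathbb N}$ satisfy $w_i^0\ge0$ for all $i$, $\sum_{i=1}^\infty i^\beta w_i^0<\infty$, and $$\sum_{i=1}^\infty i^q w_i^0<\infty\quad\text{for some } q>1 .$$ Let $w=(w_i)_{i\in\mathbb N}$ be the classical solution on $[0,+\infty)$, with initial datum $w^0$, of the discrete coagulation equations with collisional breakage constructed as a limit of truncated systems (see context). Then for each $T>0$, $$\sup_{t\in[0,T]}\sum_{i=1}^\infty i^q w_i(t)<\infty .$$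
   Context: Here $\mathbb N=\{1,2,\dots\}$. The discrete coagulation equations with collisional breakage with initial datum $w^0$ are, for all $i\in\mathbb N$, $$\frac{dw_i}{dt}=\frac12\sum_{j=1}^{i-1}p_{j,i-j}a_{j,i-j}w_jw_{i-j}-\sum_{j=1}^\infty a_{i,j}w_iw_j+\frac12\sum_{j=i+1}^\infty\sum_{k=1}^{j-1}N_{j-k,k}^i(1-p_{j-k,k})a_{j-k,k}w_{j-k}w_k,\qquad w_i(0)=w_i^0 .$$ For $T>0$, $\Omega_\beta^+(T)$ is the set of $w=(w_i)_{i\in\mathbb N}\in\mathcal C([0,T],l_1^\beta)$ with all $w_i\ge0$, where $l_1^\beta$ is the Banach space of real sequences $(y_i)$ with norm $\sum_{i=1}^\infty i^\beta|y_i|<\infty$. A classical solution on $[0,\infty)$ is a $w$ whose restriction to $[0,T]$ lies in $\Omega_\beta^+(T)$ for every $T>0$, with each $w_i$ continuously differentiable, satisfying the equations for all $i\in\mathbb N$, $t\ge0$, and the initial condition. For $n\ge2$, let $w^n=(w_i^n)_{i=1}^n$ be the unique (global, nonnegative) $C^1$ solution of the truncated system, for $1\le i\le n$, $$\frac{dw_i^n}{dt}=\frac12\sum_{j=1}^{i-1}p_{j,i-j}a_{j,i-j}w_j^nw_{i-j}^n-\sum_{j=1}^{n-i}a_{i,j}w_i^nw_j^n+\frac12\sum_{j=i+1}^n\sum_{k=1}^{j-1}N_{j-k,k}^i(1-p_{j-k,k})a_{j-k,k}w_{j-k}^nw_k^n,\qquad w_i^n(0)=w_i^0,$$ extended by $w_i^n(t)=0$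 for $i>n$; this solution satisfies $\sum_{i=1}^n i\,w_i^n(t)=\sum_{i=1}^n i\,w_i^0$ for all $t\ge0$. The constructed solution $w$ is a classical solution for which there is a subsequence $(n_l)_{l\ge1}$ such that, for every $i\in\mathbb N$ and every $T>0$, $w_i^{n_l}\to w_i$ uniformly on $[0,T]$ as $l\to\infty$. *)

(* Defs.v *)
(* Sequences indexed by {1, 2, ...} are functions on nat whose value at 0 is
   irrelevant: every sum and every quantification starts at index 1.
   Likewise only the values at times t >= 0 of a function of time matter. *)
From HB Require Import structures.
From mathcomp Require Export all_boot all_order all_algebra.
From mathcomp Require Export all_classical all_reals all_analysis.
Export Order.TTheory GRing.Theory Num.Theory.
Export numFieldNormedType.Exports.

Set Implicit Arguments.
Unset Strict Implicit.
Unset Printing Implicit Defensive.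

#[export] Set Implicit Arguments.
#[export] Unset Strict Implicit.

Local Open Scope classical_set_scope.
Local Open Scope ring_scope.

Definition moment (R : realType) (r : R) (y : nat -> R) : \bar R :=
  (\sum_(1 <= i <oo) (i%:R `^ r * y i)%:E)%E.

(* The norm of l_1^b. *)
Definition l1_norm (R : realType) (b : R) (y : nat -> R) : \bar R :=
  moment b (fun i => `|y i|).

Definition Omega_plus (R : realType) (b T : R) (w : nat -> R -> R) : Prop :=
  (forall t : R, 0 <= t <= T ->
     (l1_norm b (fun i => w i t) < +oo)%E
     /\ forall i, (1 <= i)%N -> 0 <= w i t)
  /\ (forall t0 : R, 0 <= t0 <= T ->
        l1_norm b (fun i => w i t - w i t0) @[t --> within `[0, T] (nbhs t0)]
          --> 0%E).

(* f is continuously differentiable on the closed half-line [0, +oo), with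
   derivative g.  The increments h are restricted to 0 <= t + h, so that the
   derivative is one-sided at t = 0 and two-sided at t > 0. *)
Definition C1_with_derivative (R : realType) (f g : R -> R) : Prop :=
  {within `[0, +oo[, continuous g}
  /\ forall t : R, 0 <= t ->
       h^-1 * (f (t + h) - f t) @[h --> within [set h | 0 <= t + h] 0^']
         --> g t.

Section Equations.
Variables (R : realType) (a p : nat -> nat -> R).
(* N i j s is N_{i,j}^s. *)
Variable N : nat -> nat -> nat -> R.

Definition coag_gain (y : nat -> R) (i : nat) : R :=
  2^-1 * \sum_(1 <= j < i) p j (i - j)%N * a j (i - j)%N * y j * y (i - j)%N.

(* The j-th terms of the two series of the system. *)
Definition loss_term (y : nat -> R) (i j : nat) : R := a i j * y i * y j.

Definition breakage_term (y : nat -> R) (i j : nat) : R :=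
  \sum_(1 <= k < j)
    N (j - k)%N k i * (1 - p (j - k)%N k) * a (j - k)%N k * y (j - k)%N * y k.

Definition rhs (y : nat -> R) (i : nat) : R :=
  coag_gain y i
  - limn (fun m => \sum_(1 <= j < m) loss_term y i j)
  + 2^-1 * limn (fun m => \sum_(i.+1 <= j < m) breakage_term y i j).

Definition truncated_rhs (n : nat) (y : nat -> R) (i : nat) : R :=
  coag_gain y i
  - \sum_(1 <= j < (n - i).+1) loss_term y i j
  + 2^-1 * \sum_(i.+1 <= j < n.+1) breakage_term y i j.

(* Convergence of the two series is part of satisfying the equations, since
   limn has an arbitrary value on divergent sequences. *)
Definition classical_solution (b : R) (w0 : nat -> R) (w : nat -> R -> R)
    : Prop :=
  [/\ forall T : R, 0 < T -> Omega_plus b T w,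
      forall i (t : R), (1 <= i)%N -> 0 <= t ->
        cvgn (fun m => \sum_(1 <= j < m) loss_term (fun l => w l t) i j)
        /\ cvgn (fun m =>
             \sum_(i.+1 <= j < m) breakage_term (fun l => w l t) i j),
      forall i, (1 <= i)%N ->
        C1_with_derivative (w i) (fun t => rhs (fun l => w l t) i)
    & forall i, (1 <= i)%N -> w i 0 = w0 i].

Definition truncated_solution (n : nat) (w0 : nat -> R) (v : nat -> R -> R)
    : Prop :=
  [/\ forall i (t : R), (1 <= i)%N -> 0 <= t -> 0 <= v i t,
      forall i, (1 <= i <= n)%N ->
        C1_with_derivative (v i) (fun t => truncated_rhs n (fun l => v l t) i),
      forall i, (1 <= i <= n)%N -> v i 0 = w0 i
    & forall i (t : R), (n < i)%N -> 0 <= t -> v i t = 0].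

(* A classical solution obtained as a limit of the truncated solutions along
   some subsequence (nl l), locally uniformly in time for each component. *)
Definition constructed_solution (b : R) (w0 : nat -> R) (w : nat -> R -> R)
    : Prop :=
  classical_solution b w0 w
  /\ exists (wn : nat -> nat -> R -> R) (nl : nat -> nat),
      [/\ forall n, (2 <= n)%N -> truncated_solution n w0 (wn n),
          {homo nl : l m / (l < m)%N},
          forall l, (2 <= nl l)%N
        & forall i (T : R), (1 <= i)%N -> 0 < T ->
            {uniform `[0, T], (fun l => wn (nl l) i) @ \oo --> w i}].

End Equations.

(* Main.v *)
Require Import Defs.
From mathcomp Require Import ring lra zify.

Local Open Scope classical_set_scope.
Local Open Scope ring_scope.

(** Write M_r(t) for the r-th moment of a truncated solution. A collision of
two clusters of sizes i and j redistributes the mass i + j: either into one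
cluster, or into fragments of total mass i + j. For r >= 1, fragments of total
mass i + j satisfy sum s^r <= (i + j)^r, so breakage never produces more r-th moment than
coagulation does. Testing the truncated system against i^r
([truncated_weak_form]) therefore gives the inequality of pure coagulation,

    M_r' <= 1/2 sum_(i + j <= n) a_ij w_i w_j ((i + j)^r - i^r - j^r)

([truncated_moment_rhs_le]). For r = 1 the right-hand side vanishes and M_1
does not increase. For r = q, convexity gives

    (i + j) ((i + j)^q - i^q - j^q) <= 2^(q + 1) (i j^q + j i^q)

([powRD_excess_le]); the factor i + j on the left pays for the linear growth
a_ij <= A (i + j) of the kernel, whence M_q' <= 2^(q + 1) A M_1 M_q
([truncated_superlinear_rhs_le]). By Gronwall, M_q is bounded on [0, T] by a
constant that depends on the initial datum only and not on the truncation n.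
Finitely many components of the truncated solutions converge pointwise in
time, so every partial sum of the q-th moment of the limit obeys the same
bound, and so does the whole series. *)

(** * Sums over pairs of colliding clusters *)

(** The truncated system involves exactly the collisions of total mass at most
n. Keeping both ranges up to n and putting i + j <= n in the filter makes the
symmetry in i and j an instance of exchanging two sums. *)
Definition pair_sum (R : realType) (n : nat) (F : nat -> nat -> R) : R :=
  \sum_(1 <= i < n.+1) \sum_(1 <= j < n.+1 | (i + j <= n)%N) F i j.

Lemma pair_sumC (R : realType) n (F : nat -> nat -> R) :
  pair_sum n F = pair_sum n (fun i j => F j i).
Proof.
rewrite /pair_sum (exchange_big_dep_nat xpredT) //=.
by apply: eq_bigr => i _; apply: eq_bigl => j; rewrite addnC.
Qed.

Lemma pair_sum_split (R : realType) n (F : nat -> nat -> R) :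
  \sum_(1 <= i < n.+1) \sum_(1 <= j < (n - i).+1) F i j = pair_sum n F.
Proof.
apply: eq_big_nat => i /andP[i1 i2].
rewrite (big_nat_widen 1 (n - i).+1 n.+1) ?ltnS ?leq_subr//.
by apply: eq_bigl => j /=; apply/idP/idP; lia.
Qed.

(** Groups the pairs by their total mass s, the form in which the coagulation
and breakage terms come. *)
Lemma pair_sum_diag (R : realType) n (F : nat -> nat -> R) :
  \sum_(1 <= s < n.+1) \sum_(1 <= k < s) F k (s - k)%N = pair_sum n F.
Proof.
rewrite -pair_sum_split.
transitivity
  (\sum_(1 <= s < n.+1) \sum_(1 <= k < n.+1 | (k < s)%N) F k (s - k)%N).
  by apply: eq_big_nat => s /andP[_ s2]; rewrite (big_nat_widen 1 s n.+1)// ltnW.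
rewrite (exchange_big_dep_nat xpredT)//=.
apply: eq_big_nat => k /andP[k1 k2].
transitivity (\sum_(k.+1 <= s < n.+1) F k (s - k)%N).
  by rewrite [RHS](big_nat_widenl k.+1 1).
rewrite -{1}(add1n k) big_addn subSn -1?ltnS//.
by apply: eq_big_nat => j _; rewrite addnK.
Qed.

Lemma pair_sumD (R : realType) n (F G : nat -> nat -> R) :
  pair_sum n (fun i j => F i j + G i j) = pair_sum n F + pair_sum n G.
Proof. by rewrite -big_split; apply: eq_bigr => i _; rewrite -big_split. Qed.

Lemma pair_sumN (R : realType) n (F : nat -> nat -> R) :
  pair_sum n (fun i j => - F i j) = - pair_sum n F.
Proof. by rewrite -sumrN; apply: eq_bigr => i _; rewrite -sumrN. Qed.

Lemma eq_pair_sum (R : realType) n (F G : nat -> nat -> R) :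
  (forall i j, (1 <= i)%N -> (1 <= j)%N -> F i j = G i j) ->
  pair_sum n F = pair_sum n G.
Proof.
move=> FG; apply: eq_big_nat => i /andP[i1 _].
rewrite big_nat_cond [RHS]big_nat_cond; apply: eq_bigr => j.
by move=> /andP[/andP[j1 _] _]; exact: FG.
Qed.

Lemma ler_pair_sum (R : realType) n (F G : nat -> nat -> R) :
  (forall i j, (1 <= i)%N -> (1 <= j)%N -> F i j <= G i j) ->
  pair_sum n F <= pair_sum n G.
Proof.
move=> FG; apply: ler_sum_nat => i /andP[i1 _].
rewrite big_nat_cond [leRHS]big_nat_cond; apply: ler_sum => j.
by move=> /andP[/andP[j1 _] _]; exact: FG.
Qed.

Lemma pair_sum_le (R : realType) n (F : nat -> nat -> R) :
  (forall i j, (1 <= i)%N -> (1 <= j)%N -> 0 <= F i j) ->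
  pair_sum n F <= \sum_(1 <= i < n.+1) \sum_(1 <= j < n.+1) F i j.
Proof.
move=> F0; apply: ler_sum_nat => i /andP[i1 _].
rewrite big_mkcond; apply: ler_sum_nat => j /andP[j1 _].
by case: ifP => _ //; exact: F0.
Qed.

(** Tests the truncated system against an arbitrary weight g. Each collision of
i and j contributes its rate times the expected change of the total weight:
g (i + j) with probability p_ij, the weight of the fragments otherwise, minus
the weights of the two colliding clusters. The symmetry of a_ij serves to
share the loss term equally between the two partners. *)
Lemma truncated_weak_form (R : realType) (a p : nat -> nat -> R)
    (N : nat -> nat -> nat -> R) (n : nat) (y g : nat -> R) :
  (forall i j, (1 <= i)%N -> (1 <= j)%N -> a i j = a j i) ->
  \sum_(1 <= i < n.+1) g i * truncated_rhs a p N n y i =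
  2^-1 * pair_sum n (fun i j => a i j * y i * y j *
    (p i j * g (i + j)%N
     + (1 - p i j) * (\sum_(1 <= s < i + j) g s * N i j s) - g i - g j)).
Proof.
move=> aC.
have coagE : \sum_(1 <= i < n.+1) g i * coag_gain a p y i =
    2^-1 * pair_sum n (fun i j => a i j * y i * y j * (p i j * g (i + j)%N)).
  rewrite -pair_sum_diag mulr_sumr; apply: eq_bigr => s _.
  rewrite /coag_gain mulrCA; congr (_ * _); rewrite mulr_sumr.
  by apply: eq_big_nat => k /andP[_ ks]; rewrite subnKC ?(ltnW ks)//; ring.
have lossE : \sum_(1 <= i < n.+1)
      g i * (\sum_(1 <= j < (n - i).+1) loss_term a y i j) =
    2^-1 * pair_sum n (fun i j => a i j * y i * y j * (g i + g j)).
  under eq_bigr do rewrite mulr_sumr.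
  rewrite pair_sum_split.
  (* Half of the sum is kept, in the other half i and j are exchanged. *)
  transitivity (2^-1 * (pair_sum n (fun i j => g i * loss_term a y i j) +
                        pair_sum n (fun i j => g i * loss_term a y i j))).
    by field.
  rewrite [X in _ + X]pair_sumC -pair_sumD; congr (_ * _).
  by apply: eq_pair_sum => i j i1 j1; rewrite /loss_term (aC j i)//; ring.
have breakE : \sum_(1 <= i < n.+1)
      g i * (2^-1 * \sum_(i.+1 <= j < n.+1) breakage_term a p N y i j) =
    2^-1 * pair_sum n (fun i j => a i j * y i * y j *
      ((1 - p i j) * (\sum_(1 <= s < i + j) g s * N i j s))).
  under eq_bigr do rewrite mulrCA.
  rewrite -mulr_sumr; congr (_ * _).
  rewrite pair_sumC -pair_sum_diag.
  transitivity (\sum_(1 <= i < n.+1) \sum_(1 <= j < n.+1 | (i < j)%N)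
      g i * breakage_term a p N y i j).
    by apply: eq_bigr => i _; rewrite mulr_sumr (big_nat_widenl i.+1 1).
  rewrite (exchange_big_dep_nat xpredT)//=.
  apply: eq_big_nat => s /andP[_ sn].
  transitivity (\sum_(1 <= i < s) g i * breakage_term a p N y i s).
    by rewrite [RHS](big_nat_widen 1 s n.+1)//; exact: ltnW.
  rewrite /breakage_term.
  under [LHS]eq_bigr do rewrite mulr_sumr.
  rewrite exchange_big_nat; apply: eq_big_nat => k /andP[_ ks].
  rewrite subnK ?(ltnW ks)// !mulr_sumr.
  by apply: eq_bigr => i _; ring.
under eq_bigr do rewrite /truncated_rhs mulrDr mulrBr.
rewrite big_split sumrB /= coagE lossE breakE -mulrBr -mulrDr.
congr (_ * _); rewrite -pair_sumN -!pair_sumD.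
by apply: eq_pair_sum => i j _ _; ring.
Qed.

(** * Powers and convexity *)

(** The point x + y lies on the segment from y to 2 y, at the fraction x / y;
hence (x + y)^q is at most y^q + (x / y) (2^q - 1) y^q, which shows that the
excess is linear in the smaller of the two arguments. *)
Lemma powRD_le_chord (R : realType) (q x y : R) : 1 <= q -> 0 < x -> x <= y ->
  (x + y) * ((x + y) `^ q - x `^ q - y `^ q) <= 2 * 2 `^ q * (x * y `^ q).
Proof.
move=> q1 x0 xy.
have y0 : 0 < y := lt_le_trans x0 xy.
pose t := x / y.
have t0 : 0 <= t by rewrite divr_ge0 // ltW.
have t1 : t <= 1 by rewrite ler_pdivrMr ?mul1r.
have ty : t * y = x by rewrite /t -mulrA mulVf ?mulr1 ?gt_eqF.
have := @convex_powR R q q1 (Itv01 t0 t1) (2 * y) y.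
rewrite [X in X `^ q <= _]convRE [X in _ <= X]convRE /unstable.onem /=.
rewrite !inE /= !in_itv /= !andbT.
rewrite mulr_ge0 ?(ltW y0)// => /(_ isT isT).
have -> : t * (2 * y) + (1 - t) * y = x + y by rewrite -ty; ring.
rewrite powRM ?(ltW y0)// => cvx.
have xq := powR_ge0 x q; have yq := powR_ge0 y q.
have B : (x + y) `^ q - x `^ q - y `^ q <= t * (2 `^ q * y `^ q).
  by have : 0 <= t * y `^ q by [exact: mulr_ge0]; lra.
apply: (@le_trans _ _ ((x + y) * (t * (2 `^ q * y `^ q)))).
  by rewrite ler_pM2l// addr_gt0.
have -> : 2 * 2 `^ q * (x * y `^ q) = (y + y) * (t * (2 `^ q * y `^ q)).
  by rewrite -[in LHS]ty; ring.
apply: ler_wpM2r; last by rewrite lerD2r.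
by apply: mulr_ge0 => //; apply: mulr_ge0 => //; exact: powR_ge0.
Qed.

Lemma powRD_excess_le (R : realType) (q x y : R) : 1 <= q -> 0 < x -> 0 < y ->
  (x + y) * ((x + y) `^ q - x `^ q - y `^ q) <=
  2 * 2 `^ q * (x * y `^ q + y * x `^ q).
Proof.
move=> q1 x0 y0.
have c0 u v : 0 < u -> 0 <= 2 * 2 `^ q * (u * v `^ q) :> R.
  by move=> u0; rewrite !mulr_ge0 ?powR_ge0// ltW.
wlog xy : x y x0 y0 / x <= y.
  move=> H; have [|/ltW] := leP x y; first exact: H.
  move=> /(H _ _ y0 x0).
  by rewrite (addrC y x) -!addrA (addrC (- y `^ q)) (addrC (y * _)).
apply: (le_trans (powRD_le_chord q1 x0 xy)).
by rewrite mulrDr lerDl c0.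
Qed.

(** * Gronwall's inequality and one-sided derivatives *)

(** The function f t * exp (- K t) has nonpositive derivative on t > 0, and right
continuity at 0 lets the comparison start from 0. *)
Lemma gronwall (R : realType) (f df : R -> R) (K : R) :
  (forall t : R, 0 < t -> is_derive t 1 f (df t)) ->
  f t @[t --> 0^'+] --> f 0 ->
  (forall t : R, 0 < t -> df t <= K * f t) ->
  forall t : R, 0 <= t -> f t <= f 0 * expR (K * t).
Proof.
move=> fd f0 dfK t; rewrite le_eqVlt => /orP[/eqP<-|t0].
  by rewrite mulr0 expR0 mulr1.
pose h s := f s * expR (- K * s).
have hd (s : R) : 0 < s ->
    is_derive s 1 h ((df s - K * f s) * expR (- K * s)).
  move=> s0; have fds := fd s s0.
  have ed : is_derive s 1 (fun s => expR (- K * s)) (- K * expR (- K * s)).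
    by apply: is_derive_eq; rewrite /GRing.scale /=; ring.
  by apply: is_derive_eq; rewrite /GRing.scale /=; ring.
have hc : {within `[0, t], continuous h}.
  apply/continuous_within_itvP => //; split.
  - move=> s; rewrite in_itv /= => /andP[s0 _].
    by apply/differentiable_continuous/derivable1_diffP; case: (hd s s0).
  - apply: cvgM => //.
    apply: cvg_at_right_filter.
    apply: continuous_cvg; first exact: continuous_expR.
    by apply: cvgM; [exact: cvg_cst|exact: cvg_id].
  - apply: cvg_at_left_filter.
    by apply/differentiable_continuous/derivable1_diffP; case: (hd t t0).
have : h t <= h 0.
  apply: (ler0_derive1_le_cc _ _ hc); rewrite ?in_itv /= ?lexx ?ltW//.
  - by move=> s; rewrite in_itv /= => /andP[s0 _]; case: (hd s s0).
  - move=> s; rewrite in_itv /= => /andP[s0 _].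
    rewrite derive1E; have [_ ->] := hd s s0.
    by rewrite mulr_le0_ge0 ?expR_ge0// subr_le0 dfK.
rewrite /h mulr0 expR0 mulr1 mulNr expRN ler_pdivrMr ?expR_gt0//.
Qed.

(** For t > 0 the constraint 0 <= t + h holds for all small h, so the one-sided
difference quotient of the closed half-line is the ordinary one. *)
Lemma C1_is_derive (R : realType) (f g : R -> R) (t : R) :
  C1_with_derivative f g -> 0 < t -> is_derive t 1 f (g t).
Proof.
move=> [_ /(_ t) fg] t0.
have /fg {}fg := ltW t0.
have fd : h^-1 *: ((f \o shift t) (h *: 1) - f t) @[h --> 0^'] --> g t.
  apply/cvgrPdist_lt => e e0.
  move/cvgrPdist_lt : fg => /(_ e e0); rewrite near_withinE => fg.
  have tA : \forall h \near 0^', - t < h.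
    by apply: nbhs_dnbhs; apply: lt_nbhsr; rewrite oppr_lt0.
  near=> h; rewrite /= /GRing.scale /= mulr1 (addrC h).
  near: h; apply: filterS2 fg tA => h /[swap] th; apply.
  by rewrite /= -lerBlDl sub0r ltW.
apply: DeriveDef; first by apply/cvg_ex; exists (g t).
exact/cvg_lim.
Unshelve. all: by end_near. Qed.

(** The increment f h - f 0 is h times a convergent difference quotient. *)
Lemma C1_cvg_at_right0 (R : realType) (f g : R -> R) :
  C1_with_derivative f g -> f t @[t --> 0^'+] --> f 0.
Proof.
move=> [_ /(_ 0 (lexx 0)) fg].
have fd : h^-1 * (f (0 + h) - f 0) @[h --> 0^'+] --> g 0.
  apply/cvgrPdist_lt => e e0.
  move/cvgrPdist_lt : fg => /(_ e e0); rewrite near_withinE => fg.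
  rewrite near_withinE; move: fg; rewrite near_withinE.
  apply: filterS => h fg h0.
  by apply: fg; rewrite ?gt_eqF//= add0r ltW.
rewrite -[X in _ --> X](addr0) -[X in _ --> _ + X](mul0r (g 0)).
have : f 0 + h * (h^-1 * (f (0 + h) - f 0)) @[h --> 0^'+] --> f 0 + 0 * g 0.
  apply: cvgD; first exact: cvg_cst.
  by apply: cvgM => //; apply: cvg_at_right_filter; exact: cvg_id.
apply: cvg_trans; apply: near_eq_cvg; near=> h.
have h0 : h != 0 by rewrite gt_eqF.
by rewrite mulrA divff// mul1r add0r subrKC.
Unshelve. all: by end_near. Qed.

(** * Moments of the truncated system *)

Definition truncated_moment (R : realType) (n : nat) (r : R) (y : nat -> R) : R :=
  \sum_(1 <= i < n.+1) i%:R `^ r * y i.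

Lemma truncated_moment_ge0 (R : realType) n (r : R) (y : nat -> R) :
  (forall i, (1 <= i)%N -> 0 <= y i) -> 0 <= truncated_moment n r y.
Proof.
move=> y0; rewrite /truncated_moment big_nat_cond.
by apply: sumr_ge0 => i /andP[/andP[i1 _] _]; rewrite mulr_ge0 ?powR_ge0 ?y0.
Qed.

(** Each fragment satisfies s^r = s^(r - 1) s <= m^(r - 1) s, and the fragments
have total mass m. *)
Lemma moment_fragments_le (R : realType) (m : nat) (r : R) (b : nat -> R) :
  1 <= r -> (forall s, (1 <= s < m)%N -> 0 <= b s) ->
  \sum_(1 <= s < m) s%:R * b s = m%:R ->
  \sum_(1 <= s < m) s%:R `^ r * b s <= m%:R `^ r.
Proof.
move=> r1 b0 bm.
have powS (k : nat) : (1 <= k)%N -> k%:R `^ r = k%:R `^ (r - 1) * k%:R :> R.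
  move=> k1; have k0 : k%:R != 0 :> R by rewrite pnatr_eq0 -lt0n.
  have kD := @powRD R k%:R (r - 1) 1; rewrite k0 implybT in kD.
  by rewrite -[in LHS](subrK 1 r) kD// powRr1.
have [->|m1] := posnP m; first by rewrite big_geq ?powR_ge0.
rewrite (powS _ m1) -[X in _ <= _ * X]bm mulr_sumr.
apply: ler_sum_nat => s /andP[s1 sm].
rewrite powS// -mulrA; apply: ler_wpM2r.
  by rewrite mulr_ge0// b0// s1.
apply: ge0_ler_powR; rewrite ?nnegrE ?ler0n ?subr_ge0//.
by rewrite ler_nat ltnW.
Qed.

(** Breakage drops out of the estimate: by [moment_fragments_le] the fragments
carry no more r-th moment than the cluster that coagulation would form. *)
Lemma truncated_moment_rhs_le (R : realType) (a p : nat -> nat -> R)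
    (N : nat -> nat -> nat -> R) (n : nat) (r : R) (y : nat -> R) :
  1 <= r ->
  (forall i j, (1 <= i)%N -> (1 <= j)%N -> 0 <= a i j /\ a i j = a j i) ->
  (forall i j, (1 <= i)%N -> (1 <= j)%N -> p i j <= 1) ->
  (forall i j s, (1 <= i)%N -> (1 <= j)%N -> (1 <= s < i + j)%N ->
     0 <= N i j s) ->
  (forall i j, (1 <= i)%N -> (1 <= j)%N ->
     \sum_(1 <= s < i + j) s%:R * N i j s = (i + j)%:R) ->
  (forall i, (1 <= i)%N -> 0 <= y i) ->
  truncated_moment n r (truncated_rhs a p N n y) <=
  2^-1 * pair_sum n (fun i j => a i j * y i * y j *
    ((i + j)%:R `^ r - i%:R `^ r - j%:R `^ r)).
Proof.
move=> r1 ha hp hN hNmass y0.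
rewrite /truncated_moment truncated_weak_form; last first.
  by move=> i j i1 j1; case: (ha i j i1 j1).
apply: ler_wpM2l; first by rewrite invr_ge0.
apply: ler_pair_sum => i j i1 j1; apply: ler_wpM2l.
  by rewrite !mulr_ge0 ?y0//; case: (ha i j i1 j1).
rewrite !lerD2r.
have frag : \sum_(1 <= s < i + j) s%:R `^ r * N i j s <= (i + j)%:R `^ r.
  by apply: moment_fragments_le (hNmass _ _ i1 j1) => // s; exact: hN.
have := hp i j i1 j1; rewrite -subr_ge0 => p1.
by have := ler_wpM2l p1 frag; lra.
Qed.

(** The excess (i + j) - i - j is zero, so mass cannot grow. *)
Lemma truncated_mass_rhs_le0 (R : realType) (a p : nat -> nat -> R)
    (N : nat -> nat -> nat -> R) (n : nat) (y : nat -> R) :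
  (forall i j, (1 <= i)%N -> (1 <= j)%N -> 0 <= a i j /\ a i j = a j i) ->
  (forall i j, (1 <= i)%N -> (1 <= j)%N -> p i j <= 1) ->
  (forall i j s, (1 <= i)%N -> (1 <= j)%N -> (1 <= s < i + j)%N ->
     0 <= N i j s) ->
  (forall i j, (1 <= i)%N -> (1 <= j)%N ->
     \sum_(1 <= s < i + j) s%:R * N i j s = (i + j)%:R) ->
  (forall i, (1 <= i)%N -> 0 <= y i) ->
  truncated_moment n 1 (truncated_rhs a p N n y) <= 0.
Proof.
move=> ha hp hN hNmass y0.
apply: (le_trans (truncated_moment_rhs_le n (lexx 1) ha hp hN hNmass y0)).
rewrite (@eq_pair_sum _ _ _ (fun _ _ => 0)) ?big1 ?mulr0//.
  by rewrite /pair_sum big1 ?mulr0// => i _; rewrite big1.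
by move=> i j _ _; rewrite !powRr1// natrD; ring.
Qed.

(** The factor i + j allowed in the kernel a turns the excess into the products
i j^q and i^q j, whose sums over all pairs factor as M_1 M_q. The excess is
divided by i + j before a is bounded, so that only the nonnegative upper bound
gets multiplied by A (i + j). *)
Lemma truncated_superlinear_rhs_le (R : realType) (a p : nat -> nat -> R)
    (N : nat -> nat -> nat -> R) (n : nat) (A q : R) (y : nat -> R) :
  1 <= q -> 0 <= A ->
  (forall i j, (1 <= i)%N -> (1 <= j)%N -> 0 <= a i j /\ a i j = a j i) ->
  (forall i j, (1 <= i)%N -> (1 <= j)%N -> a i j <= A * (i + j)%:R) ->
  (forall i j, (1 <= i)%N -> (1 <= j)%N -> p i j <= 1) ->
  (forall i j s, (1 <= i)%N -> (1 <= j)%N -> (1 <= s < i + j)%N ->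
     0 <= N i j s) ->
  (forall i j, (1 <= i)%N -> (1 <= j)%N ->
     \sum_(1 <= s < i + j) s%:R * N i j s = (i + j)%:R) ->
  (forall i, (1 <= i)%N -> 0 <= y i) ->
  truncated_moment n q (truncated_rhs a p N n y) <=
  2 * 2 `^ q * A * truncated_moment n 1 y * truncated_moment n q y.
Proof.
move=> q1 A0 ha haA hp hN hNmass y0.
apply: (le_trans (truncated_moment_rhs_le n q1 ha hp hN hNmass y0)).
pose C : R := 2 * 2 `^ q * A.
pose F i j : R := i%:R `^ 1 * y i * (j%:R `^ q * y j).
have C0 : 0 <= C by rewrite !mulr_ge0 ?powR_ge0.
have F0 i j : (1 <= i)%N -> (1 <= j)%N -> 0 <= F i j.
  by move=> i1 j1; rewrite !mulr_ge0 ?powR_ge0 ?y0.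
have -> : 2 * 2 `^ q * A * truncated_moment n 1 y * truncated_moment n q y =
    2^-1 * (C * (\sum_(1 <= i < n.+1) \sum_(1 <= j < n.+1) F i j) +
            C * (\sum_(1 <= i < n.+1) \sum_(1 <= j < n.+1) F i j)).
  rewrite /F -big_distrlr /= -/(truncated_moment n 1 y).
  by rewrite -/(truncated_moment n q y) /C; field.
apply: ler_wpM2l; first by rewrite invr_ge0.
apply: (@le_trans _ _ (pair_sum n (fun i j => C * F i j + C * F j i))).
  apply: ler_pair_sum => i j i1 j1.
  have i0 : 0 < i%:R :> R by rewrite ltr0n.
  have j0 : 0 < j%:R :> R by rewrite ltr0n.
  have := powRD_excess_le q1 i0 j0; rewrite -natrD.
  set D := _ - _ - _; set E := _ + j%:R * _ => DE.
  have s0 : 0 < (i + j)%:R :> R by rewrite ltr0n addn_gt0 i1.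
  have yy : 0 <= y i * y j by rewrite mulr_ge0 ?y0.
  have aD : a i j * D <= A * (2 * 2 `^ q * E).
    have E0 : 0 <= 2 * 2 `^ q * E.
      by rewrite !mulr_ge0 ?addr_ge0 ?mulr_ge0 ?powR_ge0.
    have [a0 _] := ha i j i1 j1.
    have DE' : D <= 2 * 2 `^ q * E / (i + j)%:R by rewrite ler_pdivlMr// mulrC.
    apply: (le_trans (ler_wpM2l a0 DE')).
    rewrite [leLHS]mulrA ler_pdivrMr// [leRHS]mulrAC; apply: ler_wpM2r => //.
    exact: haA.
  have -> : a i j * y i * y j * D = (y i * y j) * (a i j * D) by ring.
  have -> : C * F i j + C * F j i = (y i * y j) * (A * (2 * 2 `^ q * E)).
    by rewrite /F /E /C !powRr1 ?ler0n//; ring.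
  exact: ler_wpM2l.
have CF : pair_sum n (fun i j => C * F i j) <=
    C * (\sum_(1 <= i < n.+1) \sum_(1 <= j < n.+1) F i j).
  apply: le_trans (pair_sum_le _ _) _ => [i j i1 j1|].
    by rewrite mulr_ge0// F0.
  by rewrite mulr_sumr; apply: ler_sum => i _; rewrite mulr_sumr.
by rewrite pair_sumD [X in _ + X]pair_sumC lerD.
Qed.

Lemma truncated_moment_gronwall (R : realType) (a p : nat -> nat -> R)
    (N : nat -> nat -> nat -> R) (n : nat) (w0 : nat -> R)
    (v : nat -> R -> R) (r K : R) :
  truncated_solution a p N n w0 v ->
  (forall t, 0 < t ->
     truncated_moment n r (truncated_rhs a p N n (fun l => v l t)) <=
     K * truncated_moment n r (fun l => v l t)) ->
  forall t, 0 <= t ->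
    truncated_moment n r (fun l => v l t) <=
    truncated_moment n r w0 * expR (K * t).
Proof.
move=> [v0 vd vi _] dK t t0.
have vd' (i : 'I_n) := vd i.+1 (ltn_ord i : (1 <= i.+1 <= n)%N).
(* Sums over ordinals are what the derivation rule for finite sums expects. *)
have momE (y : nat -> R) :
    truncated_moment n r y = \sum_(i < n) i.+1%:R `^ r * y i.+1.
  by rewrite /truncated_moment big_add1 big_mkord.
have -> : truncated_moment n r w0 = truncated_moment n r (fun l => v l 0).
  by apply: eq_big_nat => i /andP[i1 i2]; rewrite vi ?i1.
apply: (@gronwall _ (fun t => truncated_moment n r (fun l => v l t))
  (fun t => truncated_moment n r (truncated_rhs a p N n (fun l => v l t)))
  K _ _ dK t t0).
- move=> s s0; rewrite momE.
  have -> : (fun t => truncated_moment n r (fun l => v l t)) =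
      \sum_(i < n) (fun t => i.+1%:R `^ r * v i.+1 t).
    by apply/funext => u; rewrite momE fct_sumE.
  apply: is_derive_sum => i.
  have vds := C1_is_derive (vd' i) s0.
  by apply: is_derive_eq; rewrite /GRing.scale /=; ring.
- rewrite momE; under eq_fun do rewrite momE.
  apply: cvg_big => [|i _]; first by apply: add_continuous.
  by apply: cvgM; [exact: cvg_cst|exact: C1_cvg_at_right0 (vd' i)].
Qed.

(** * Passage to the limit *)

(** Taking r = 1 and r = q, this bounds both the initial mass and the initial
q-th moment by one constant independent of n. *)
Lemma truncated_moment_le_moment (R : realType) n (q r : R) (y : nat -> R) :
  (forall i, (1 <= i)%N -> 0 <= y i) -> (moment q y < +oo)%E -> r <= q ->
  truncated_moment n r y <= fine (moment q y).
Proof.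
move=> y0 yfin rq.
have t0 i : (1 <= i)%N -> (0 <= (i%:R `^ q * y i)%:E)%E.
  by move=> i1; rewrite lee_fin mulr_ge0 ?powR_ge0 ?y0.
have mge : ((truncated_moment n q y)%:E <= moment q y)%E.
  by rewrite /truncated_moment -sumEFin; apply: nneseries_lim_ge => i /t0.
apply: (@le_trans _ _ (truncated_moment n q y)).
  apply: ler_sum_nat => i /andP[i1 _]; apply: ler_wpM2r; first exact: y0.
  by rewrite ler_powR// ler1n.
rewrite -lee_fin fineK// ge0_fin_numE//.
by apply: nneseries_ge0 => i i1 _; exact: t0.
Qed.

Lemma moment_le (R : realType) (q B : R) (y : nat -> R) :
  (forall i, (1 <= i)%N -> 0 <= y i) ->
  (forall m, truncated_moment m q y <= B) -> (moment q y <= B%:E)%E.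
Proof.
move=> y0 yB; apply: lime_le.
  apply: is_cvg_nneseries => i i1 _.
  by rewrite lee_fin mulr_ge0 ?powR_ge0 ?y0.
near=> m; have m1 : (1 <= m)%N by near: m; exists 1%N.
by rewrite sumEFin lee_fin -(prednK m1); exact: yB.
Unshelve. all: by end_near. Qed.

Theorem proposition6p1 (R : realType) (beta : R)
  (a p : nat -> nat -> R) (N : nat -> nat -> nat -> R)
  (A alpha0 q : R) (w0 : nat -> R) (w : nat -> R -> R)
  (hbeta : 1 < beta <= 2)
  (hA : 0 < A)
  (ha : forall i j, (1 <= i)%N -> (1 <= j)%N ->
     0 <= a i j /\ a i j = a j i /\ a i j <= A * (i + j)%:R)
  (hp : forall i j, (1 <= i)%N -> (1 <= j)%N ->
     0 <= p i j /\ p i j = p j i /\ p i j <= 1)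
  (hN : forall i j s, (1 <= i)%N -> (1 <= j)%N -> (1 <= s < i + j)%N ->
     0 <= N i j s /\ N i j s = N j i s /\ N i j s <= alpha0)
  (hNmass : forall i j, (1 <= i)%N -> (1 <= j)%N ->
     \sum_(1 <= s < i + j) s%:R * N i j s = (i + j)%:R)
  (hw0 : forall i, (1 <= i)%N -> 0 <= w0 i)
  (hw0beta : (moment beta w0 < +oo)%E)
  (hq : 1 < q)
  (hw0q : (moment q w0 < +oo)%E)
  (hw : constructed_solution a p N beta w0 w) :
  forall T : R, 0 < T ->
    (ereal_sup [set moment q (fun i => w i t) | t in `[0%R, T]] < +oo)%E.
Proof.
move=> T T0.
have [[wOmega _ _ _] [wn [nl [wnsol nlincr nl2 wncvg]]]] := hw.
have a0C i j : (1 <= i)%N -> (1 <= j)%N -> 0 <= a i j /\ a i j = a j i.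
  by move=> i1 j1; have [a0 [aC _]] := ha i j i1 j1.
have aA i j : (1 <= i)%N -> (1 <= j)%N -> a i j <= A * (i + j)%:R.
  by move=> i1 j1; have [_ []] := ha i j i1 j1.
have p1 i j : (1 <= i)%N -> (1 <= j)%N -> p i j <= 1.
  by move=> i1 j1; have [_ []] := hp i j i1 j1.
have N0 i j s : (1 <= i)%N -> (1 <= j)%N -> (1 <= s < i + j)%N -> 0 <= N i j s.
  by move=> i1 j1 sij; have [] := hN i j s i1 j1 sij.
pose B := fine (moment q w0).
have w0B n r : r <= q -> truncated_moment n r w0 <= B.
  exact: truncated_moment_le_moment.
have B0 : 0 <= B := le_trans (truncated_moment_ge0 0 q hw0) (w0B 0 q (lexx q)).
pose C := 2 * 2 `^ q * A.
have C0 : 0 <= C by rewrite !mulr_ge0 ?powR_ge0 ?(ltW hA).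
pose S := B * expR (C * B * T).
have trunc_bound n t : (2 <= n)%N -> 0 <= t <= T ->
    truncated_moment n q (fun l => wn n l t) <= S.
  move=> n2 /andP[t0 tT]; have sol := wnsol n n2.
  have v0 s : 0 <= s -> forall i, (1 <= i)%N -> 0 <= wn n i s.
    by move=> s0 i i1; case: sol => + _ _ _; apply.
  have mass s : 0 <= s -> truncated_moment n 1 (fun l => wn n l s) <= B.
    move=> s0; apply: le_trans (w0B n 1 (ltW hq)).
    have := truncated_moment_gronwall (r := 1) (K := 0) sol _ s0.
    rewrite mul0r expR0 mulr1; apply => u u0; rewrite mul0r.
    exact: (truncated_mass_rhs_le0 n a0C p1 N0 hNmass (v0 u (ltW u0))).
  apply: (le_trans (truncated_moment_gronwall (r := q) (K := C * B) sol _ t0)).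
    move=> u u0; have vu0 := v0 u (ltW u0).
    apply: le_trans (truncated_superlinear_rhs_le n (ltW hq) (ltW hA) a0C aA
      p1 N0 hNmass vu0) _.
    apply: ler_wpM2r; first exact: truncated_moment_ge0.
    by apply: ler_wpM2l => //; exact: mass (ltW u0).
  apply: ler_pM; rewrite ?expR_ge0 ?truncated_moment_ge0 ?w0B//.
  by rewrite ler_expR ler_wpM2l// mulr_ge0.
apply: (@le_lt_trans _ _ S%:E); last exact: ltry.
apply: ge_ereal_sup => _ [t + <-]; rewrite /= in_itv /= => tT.
have [wfin _] := wOmega T T0; have [_ w0t] := wfin t tT.
apply: moment_le => // m.
have wnt i : (1 <= i)%N -> wn (nl l) i t @[l --> \oo] --> w i t.
  move=> i1; have := wncvg i T i1 T0.
  have tsub : [set t] `<=` `[0, T] by move=> _ ->; rewrite /= in_itv.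
  by move=> /(uniform_subset_cvg _ tsub); rewrite uniform_set1.
have cvgm : truncated_moment m q (fun i => wn (nl l) i t) @[l --> \oo] -->
    truncated_moment m q (fun i => w i t).
  rewrite /truncated_moment big_nat; under eq_fun do rewrite big_nat.
  apply: cvg_big => [|i /andP[i1 _]]; first by apply: add_continuous.
  by apply: cvgM; [exact: cvg_cst|exact: wnt].
apply: (closed_cvg _ (@closed_le _ S) _ _ cvgm).
have nlge l : (l <= nl l)%N.
  elim: l => // l IH; exact: leq_ltn_trans IH (nlincr _ _ (ltnSn l)).
(* The truncation index must be at least m, so that the m components considered are
   among those controlled by the moment of the truncated solution. *)
near=> l.
have ml : (m <= nl l)%N.
  by apply: leq_trans (nlge l); near: l; exists m.
apply: le_trans (trunc_bound (nl l) t (nl2 l) tT).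
rewrite /truncated_moment [leRHS](big_cat_nat (n := m.+1))//= lerDl.
rewrite big_nat_cond; apply: sumr_ge0 => i /andP[/andP[mi _] _].
have i1 : (1 <= i)%N := leq_trans (ltn0Sn m) mi.
have [v0 _ _ _] := wnsol (nl l) (nl2 l).
by rewrite mulr_ge0 ?powR_ge0// v0//; case/andP: tT.
Unshelve. all: by end_near. Qed.
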